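(* Let $n \ge 2$, let $K$ be a (non-archimedean) local field, and let $Y_n$ be the graph of special vertices of the affine building $\Delta_n$ of $\mathrm{Sp}_n(K)$. Let $o$ be the class of the standard lattice, $Q$ the subgroup of $\mathrm{PGSp}_n(K)$ and $x_{\underline{\varepsilon}}$ ($\underline{\varepsilon}\in\{0,1\}^n$) the vertices defined in the context, and $Q_o$ the stabilizer of $o$ in $Q$. Then the set of vertices of $Y_n$ adjacent to $o$ is $$N(o)=\bigcup_{\underline{\varepsilon}\in\{0,1\}^n} Q_o\,x_{\underline{\varepsilon}},$$ where $Q_o x_{\underline{\varepsilon}}=\{g x_{\underline{\varepsilon}}: g\in Q_o\}$.
   Context: $K$ is a local field with discrete valuation $\mathrm{ord}$, valuation ring $\mathcal{O}$, uniformizer $\pi$, residue field $k\cong\mathbb{F}_q$. $V=K^{2n}$ with standard symplectic basis $e_1,\dots,e_n,f_1,\dots,f_n$ ($f_i=e_{n+i}$) and alternating form $\langle e_i,f_j\rangle=\delta_{ij}$, $\langle e_i,e_j\rangle=0=\langle f_i,f_j\rangle$. A lattice in $V$ is a free rank-$2n$ $\mathcal{O}$-submodule of $V$; lattices $L,L'$ are homothetic if $L'=\alpha L$ for some $\alpha\in K^\times$, and $[L]$ is the homothety class of $L$. A lattice $L$ is primitive if $\langle L,L\rangle\subseteq\mathcal{O}$ and $\langle\cdot,\cdot\rangle$ induces a non-degenerate alternating $k$-bilinear form on $L/\pi L$. The building $\Delta_n$: a vertex of $\Delta_n$ is a homothety class of lattices having a representative $L$ for which there is a primitive lattice $L_0$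 with $\langle L,L\rangle\subseteq\pi\mathcal{O}$ and $\pi L_0\subseteq L\subseteq L_0$. Two vertices $t,t'$ are incident if there are representatives $L\in t$, $L'\in t'$ and a primitive lattice $L_0$ with $\langle L,L\rangle\subseteq\pi\mathcal{O}$, $\langle L',L'\rangle\subseteq\pi\mathcal{O}$, and either $\pi L_0\subseteq L\subseteq L'\subseteq L_0$ or $\pi L_0\subseteq L'\subseteq L\subseteq L_0$. Two distinct incident vertices are called adjacent. A basis $\{u_1,\dots,u_n,w_1,\dots,w_n\}$ of $V$ is symplectic if $\langle u_i,w_j\rangle=\delta_{ij}$ and $\langle u_i,u_j\rangle=0=\langle w_i,w_j\rangle$ for all $i,j$. A vertex $[L]$ of $\Delta_n$ is special if, writing $L=\sum_i\mathcal{O}\pi^{a_i}u_i+\sum_i\mathcal{O}\pi^{b_i}w_i$ in a symplectic basis (with $a_i,b_i\in\mathbb{Z}$), the sum $a_i+b_i$ is the same for all $i$ (this does not depend on the choices). $Y_n$ is the graph whose vertices are the special vertices of $\Delta_n$, two of them being joined by an edge iff they are adjacent in $\Delta_n$. $\mathrm{GSp}_n(K)$ is the group of $g=\begin{pmatrix}A&B\\C&D\end{pmatrix}\in M_{2n}(K)$ with $A,B,C,D\in M_n(K)$, $A^tC=C^tA$, $B^tD=D^tB$, $A^tD-C^tB=\nu(g)I_n$ for some $\nu(g)\in K^\times$; $\mathrm{PGSp}_n(K)=\mathrm{GSp}_n(K)/K^\times$ (modulo scalar matrices). It acts on the vertices of $Y_n$ by $g[L]=[gL]$. $Q$ is the image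 in $\mathrm{PGSp}_n(K)$ of $$Q'=\left\{\begin{pmatrix}A&B\\0&D\end{pmatrix}\in\mathrm{GSp}_n(K): A\in M_n(K)\text{ upper triangular}\right\}.$$ $o=[\mathcal{O}^{2n}]$, and for $\underline{\varepsilon}=(\varepsilon_1,\dots,\varepsilon_n)\in\{0,1\}^n$, $x_{\underline{\varepsilon}}=\big[\sum_i\mathcal{O}\pi^{\varepsilon_i}e_i+\sum_i\mathcal{O}\pi^{1-\varepsilon_i}f_i\big]$. *)

(* Defs.v *)
From mathcomp Require Import all_boot all_order all_algebra.
From mathcomp Require Import classical_sets.

Set Implicit Arguments.
Unset Strict Implicit.
Unset Printing Implicit Defensive.

Import Order.TTheory GRing.Theory Num.Theory.
Local Open Scope classical_set_scope.
Local Open Scope ring_scope.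

(* A discrete valuation is given by its values on K^*; ord 0 is unspecified, and
   [val_ge ord N x] means ord x >= N with the convention ord 0 = +oo. *)
Definition val_ge (K : fieldType) (ord : K -> int) (N : int) : set K :=
  [set x | x = 0 \/ N <= ord x].

Definition val_ring (K : fieldType) (ord : K -> int) : set K := val_ge ord 0.

Record is_local_field (K : fieldType) (ord : K -> int) : Prop := IsLocalField {
  ord_mul : forall x y : K, x != 0 -> y != 0 -> ord (x * y) = ord x + ord y;
  ord_add : forall x y : K, x != 0 -> y != 0 -> x + y != 0 ->
    Num.min (ord x) (ord y) <= ord (x + y);
  ord_surj : forall m : int, exists2 x : K, x != 0 & ord x = m;
  residue_finite : exists s : seq K, forall x : K, val_ring ord x ->
    exists2 y : K, y \in s & val_ring ord y /\ val_ge ord 1 (x - y);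
  ord_complete : forall u : nat -> K,
    (forall N : int, exists M : nat, forall i j : nat,
        (M <= i)%N -> (M <= j)%N -> val_ge ord N (u i - u j)) ->
    exists l : K, forall N : int, exists M : nat, forall i : nat,
        (M <= i)%N -> val_ge ord N (u i - l)
}.

Definition uniformizer (K : fieldType) (ord : K -> int) (pi : K) : Prop :=
  pi != 0 /\ ord pi = 1.

Section SymplecticSpace.
Context {K : fieldType} {n : nat}.
Local Notation V := 'cV[K]_(n + n).

Definition std_e (i : 'I_n) : V := delta_mx (lshift n i) 0.
Definition std_f (i : 'I_n) : V := delta_mx (rshift n i) 0.

Definition form (x y : V) : K :=
  \sum_(i < n) (x (lshift n i) 0 * y (rshift n i) 0
                - x (rshift n i) 0 * y (lshift n i) 0).

Definition symplectic_basis (u w : 'I_n -> V) : Prop :=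
  [/\ basis_of {:V} ([seq u i | i : 'I_n] ++ [seq w i | i : 'I_n]),
      forall i j, form (u i) (w j) = (i == j)%:R,
      forall i j, form (u i) (u j) = 0
    & forall i j, form (w i) (w j) = 0].

Definition dilate (a : K) (L : set V) : set V := [set a *: x | x in L].

Definition hclass (L : set V) : set (set V) :=
  [set L' | exists2 a : K, a != 0 & L' = dilate a L].

Definition GSp : set 'M[K]_(n + n) :=
  [set g | let A := ulsubmx g in let B := ursubmx g in
           let C := dlsubmx g in let D := drsubmx g in
     [/\ A^T *m C = C^T *m A, B^T *m D = D^T *m B
       & exists2 nu : K, nu != 0 & A^T *m D - C^T *m B = nu%:M]].

(* The class of g in PGSp = GSp / K^*, as a coset of the scalar matrices. *)
Definition PGclass (g : 'M[K]_(n + n)) : set 'M[K]_(n + n) :=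
  [set a *: g | a in [set a : K | a != 0]].

Definition Qprime : set 'M[K]_(n + n) :=
  [set g | [/\ GSp g, dlsubmx g = 0
             & forall i j : 'I_n, (j < i)%N -> ulsubmx g i j = 0]].

Definition Qgroup : set (set 'M[K]_(n + n)) := PGclass @` Qprime.

Definition mul_lattice (g : 'M[K]_(n + n)) (L : set V) : set V :=
  [set g *m x | x in L].

(* The product of all representatives of G with all representatives of t;
   see [PGactE]. *)
Definition PGact (G : set 'M[K]_(n + n)) (t : set (set V)) : set (set V) :=
  [set mul_lattice g L | g in G & L in t].

Lemma PGactE (g : 'M[K]_(n + n)) (L : set V) :
  PGact (PGclass g) (hclass L) = hclass (mul_lattice g L).
Proof.
apply/seteqP; split => M /=.
- move=> [_ [a a0 <-]] [_ [b b0 ->]] <-.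
  exists (a * b); first by rewrite mulf_neq0.
  apply/seteqP; split => x /=.
  + move=> [_ [y Ly <-] <-]; exists (g *m y); first by exists y.
    by rewrite -scalemxAr -scalemxAl scalerA mulrC.
  + move=> [_ [y Ly <-] <-]; exists (b *: y); first by exists y.
    by rewrite -scalemxAr -scalemxAl scalerA mulrC.
- move=> [b b0 ->]; exists g; first by exists 1; rewrite ?scale1r //= oner_neq0.
  exists (dilate b L); first by exists b.
  apply/seteqP; split => x /=.
  + move=> [_ [y Ly <-] <-]; exists (g *m y); first by exists y.
    by rewrite -scalemxAr.
  + move=> [_ [y Ly <-] <-]; exists (b *: y); first by exists y.
    by rewrite -scalemxAr.
Qed.

Definition Qstab (t : set (set V)) : set (set 'M[K]_(n + n)) :=
  [set G | Qgroup G /\ PGact G t = t].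

Section Building.
Variables (ord : K -> int) (pi : K).
Local Notation O := (val_ring ord).

Definition is_lattice (L : set V) : Prop :=
  exists b : 'I_(n + n) -> V,
    (forall c : 'I_(n + n) -> K, (forall i, O (c i)) ->
       \sum_i c i *: b i = 0 -> forall i, c i = 0) /\
    L = [set x | exists2 c : 'I_(n + n) -> K,
                   forall i, O (c i) & x = \sum_i c i *: b i].

Definition piO : set K := [set pi * x | x in O].

Definition form_in (I : set K) (L : set V) : Prop :=
  forall x y, L x -> L y -> I (form x y).

(* The last clause says that the form induced on L / pi L, with values in
   O / pi O, has trivial radical. *)
Definition primitive (L : set V) : Prop :=
  [/\ is_lattice L, form_in O L
    & forall x, L x -> (forall y, L y -> piO (form x y)) -> dilate pi L x].

Definition is_vertex (t : set (set V)) : Prop :=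
  exists L L0 : set V,
    [/\ is_lattice L, t = hclass L, primitive L0, form_in piO L
      & dilate pi L0 `<=` L /\ L `<=` L0].

Definition incident (t t' : set (set V)) : Prop :=
  [/\ is_vertex t, is_vertex t'
    & exists L L' L0 : set V,
      [/\ t L, t' L', primitive L0, form_in piO L /\ form_in piO L'
        & [/\ dilate pi L0 `<=` L, L `<=` L' & L' `<=` L0] \/
          [/\ dilate pi L0 `<=` L', L' `<=` L & L `<=` L0]]].

Definition adjacent (t t' : set (set V)) : Prop := t <> t' /\ incident t t'.

Definition frame_lattice (u w : 'I_n -> V) (a b : 'I_n -> int) : set V :=
  [set x | exists c d : 'I_n -> K,
     [/\ forall i, O (c i), forall i, O (d i)
       & x = \sum_i c i *: (pi ^ a i *: u i) + \sum_i d i *: (pi ^ b i *: w i)]].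

Definition special (t : set (set V)) : Prop :=
  is_vertex t /\
  exists (u w : 'I_n -> V) (a b : 'I_n -> int),
    [/\ symplectic_basis u w, t = hclass (frame_lattice u w a b)
      & forall i j, a i + b i = a j + b j].

Definition Yn_edge (t t' : set (set V)) : Prop :=
  [/\ special t, special t' & adjacent t t'].

Definition Yn_neighbors (t : set (set V)) : set (set (set V)) :=
  [set t' | Yn_edge t t'].

Definition vertex_o : set (set V) :=
  hclass [set x : V | forall i, O (x i 0)].

Definition vertex_x (eps : {ffun 'I_n -> bool}) : set (set V) :=
  hclass (frame_lattice std_e std_f
            (fun i => (eps i : nat)%:Z) (fun i => 1 - (eps i : nat)%:Z)).

End Building.
End SymplecticSpace.

Arguments vertex_o {K} n ord.

(* Main.v *)
From mathcomp Require Import all_boot all_order all_algebra.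
From mathcomp Require Import boolp classical_sets.
From mathcomp Require Import zify ring.
Require Import Defs.

(** Everything takes place between [pi O^(2n)] and [O^(2n)].  Call [L] modular of
    level [c] if it is its own dual for [pi ^ (- c) form].  Special vertices are
    the classes of modular lattices ([modular_frame]), and a special vertex is
    adjacent to the standard one exactly when it has a representative [L] of level 1
    inside [O^(2n)]; such an [L] automatically contains [pi O^(2n)], and
    [L / pi O^(2n)] is a maximal isotropic subspace of the symplectic space
    [k^(2n)].  In one direction this comes from comparing levels along the chain of
    inclusions that defines incidence ([primitive_squeeze], [neighbor_in_orbit]);
    in the other, stabilizing the class of [O^(2n)] pins down the valuation of the
    multiplier, so that the translates of the reference vertices are again of this
    kind ([orbit_neighbor]).

    It remains to see that every such [L] is carried to one of the [2 ^ n] coordinate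
    lattices by an element of [Qprime] preserving [O^(2n)].  Over the residue field
    this is the Bruhat decomposition for maximal isotropic subspaces, and
    elimination works directly over [O] ([integral_borel_reduction]).  The pairs
    [(e_k, f_k)] are treated in the order of the flag stabilized by [Qprime].  If
    [e_k] is in [L], the pair is settled.  Otherwise duality gives a vector of [L]
    with [f_k]-coordinate 1, which can be cleared of its coordinates in the pairs
    already treated ([pivot]); the Eichler transformation along [e_k] that takes this vector to
    [f_k] is integral, preserves the flag and fixes the earlier pairs.  In the end
    [L] contains one vector of each pair, and self-duality identifies it. *)

Set Implicit Arguments.
Unset Strict Implicit.
Unset Printing Implicit Defensive.

Import Order.TTheory GRing.Theory Num.Theory.
Local Open Scope classical_set_scope.
Local Open Scope ring_scope.

(** * The valuation *)

Section Valuation.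
Context (K : fieldType) (ord : K -> int) (hK : is_local_field ord).
Local Notation vge := (val_ge ord).

Lemma ord_one : ord 1 = 0.
Proof. by apply: (addrI (ord 1)); rewrite addr0 -(ord_mul hK) ?oner_neq0 // mulr1. Qed.

Lemma ord_opp1 : ord (-1) = 0.
Proof.
have h : (-1 : K) != 0 by rewrite oppr_eq0 oner_neq0.
by have := ord_mul hK h h; rewrite mulrNN mulr1 ord_one; lia.
Qed.

Lemma ordV x : x != 0 -> ord x^-1 = - ord x.
Proof.
move=> x0; have xV0 : x^-1 != 0 by rewrite invr_eq0.
by have := ord_mul hK x0 xV0; rewrite divff // ord_one; lia.
Qed.

Lemma val_ge0 N : vge N 0. Proof. by left. Qed.

Lemma val_ge_leq M N x : N <= M -> vge M x -> vge N x.
Proof. by move=> h [->|hx]; [left|right; lia]. Qed.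

Lemma val_geD N x y : vge N x -> vge N y -> vge N (x + y).
Proof.
have [->|x0] := eqVneq x 0; first by rewrite add0r.
have [->|y0] := eqVneq y 0; first by rewrite addr0.
have [-> _ _|xy0] := eqVneq (x + y) 0; first by left.
move=> [/eqP|hx]; first by rewrite (negPf x0).
move=> [/eqP|hy]; first by rewrite (negPf y0).
by right; have := ord_add hK x0 y0 xy0; lia.
Qed.

Lemma val_geM M N x y : vge M x -> vge N y -> vge (M + N) (x * y).
Proof.
have [->|x0] := eqVneq x 0; first by rewrite mul0r; left.
have [->|y0] := eqVneq y 0; first by rewrite mulr0; left.
move=> [/eqP|hx]; first by rewrite (negPf x0).
move=> [/eqP|hy]; first by rewrite (negPf y0).
by right; rewrite ord_mul //; lia.
Qed.

Lemma val_geN N x : vge N x -> vge N (- x).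
Proof.
move=> hx; rewrite -mulN1r -[N]add0r; apply: val_geM => //.
by right; rewrite ord_opp1.
Qed.

Lemma val_geB N x y : vge N x -> vge N y -> vge N (x - y).
Proof. by move=> hx hy; apply: val_geD => //; apply: val_geN. Qed.

Lemma val_ge_sum N (I : finType) (F : I -> K) :
  (forall i, vge N (F i)) -> vge N (\sum_i F i).
Proof.
move=> hF; apply: (big_ind (fun x => vge N x)) => //; first exact: val_ge0.
exact: val_geD.
Qed.

(** Exact, unlike [val_geM]: multiplication by a nonzero scalar shifts valuations. *)
Lemma val_geZ N a x : a != 0 -> vge (ord a + N) (a * x) <-> vge N x.
Proof.
move=> a0; split=> [h|]; last by apply: val_geM; right.
rewrite -(mulKf a0 x) (_ : N = - ord a + (ord a + N)); last by lia.
by apply: val_geM => //; right; rewrite ordV.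
Qed.

Context (pi : K) (hpi : uniformizer ord pi).

Let pi0 : pi != 0. Proof. by case: hpi. Qed.

Lemma ord_expz (z : int) : ord (pi ^ z) = z.
Proof.
have hn m : ord (pi ^+ m) = m%:Z.
  elim: m => [|m IH]; first by rewrite expr0 ord_one.
  by rewrite exprS ord_mul ?expf_neq0 // IH; case: hpi => _ ->; lia.
by case: z => m; rewrite ?NegzE -?exprnN -?exprnP ?ordV ?hn ?expf_neq0.
Qed.

Lemma val_ge_expz N (z : int) : vge N (pi ^ z) <-> N <= z.
Proof.
split=> [[/eqP|]|h]; first by rewrite expfz_eq0 (negPf pi0) andbF.
- by rewrite ord_expz.
- by right; rewrite ord_expz.
Qed.

Lemma val_ge_divz N (z : int) x : vge N x -> vge (N - z) (x / pi ^ z).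
Proof.
move=> hx; apply: val_geM => //; right.
by rewrite ordV ?ord_expz // expfz_neq0.
Qed.

Lemma piOE : piO ord pi = vge 1.
Proof.
case: hpi => _ ordpi.
apply/seteqP; split=> [_ [x hx <-]|x hx] /=.
  by rewrite -[1]addr0 -{1}ordpi; apply/val_geZ.
exists (pi^-1 * x); last by rewrite mulVKf.
by apply/(val_geZ _ _ pi0); rewrite mulVKf // ordpi.
Qed.

End Valuation.

(** * The symplectic form and its similitudes *)

Section Form.
Context (K : fieldType) (n : nat).
Local Notation V := 'cV[K]_(n + n).
Implicit Types (x y z : V) (g h : 'M[K]_(n + n)) (i j : 'I_n).

(** The Gram matrix of [form] in the standard basis; the three block equations
    defining [GSp] say that [g^T *m gram *m g] is a scalar multiple of it. *)
Definition gram : 'M[K]_(n + n) := block_mx 0 1%:M (- 1%:M) 0.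

Lemma form_gram x y : form x y = (x^T *m gram *m y) 0 0.
Proof.
rewrite -[x in RHS]vsubmxK -[y in RHS]vsubmxK tr_col_mx.
rewrite /gram mul_row_block !mulmx0 add0r addr0 mulmx1 mulmxN mulmx1.
rewrite mul_row_col !mxE /form -big_split /=.
under [RHS]eq_bigr do rewrite !mxE mulNr addrC.
by [].
Qed.

Lemma formDl x y z : form (x + y) z = form x z + form y z.
Proof. by rewrite !form_gram raddfD /= !mulmxDl mxE. Qed.

Lemma formDr x y z : form x (y + z) = form x y + form x z.
Proof. by rewrite !form_gram mulmxDr mxE. Qed.

Lemma formZl a x y : form (a *: x) y = a * form x y.
Proof. by rewrite !form_gram linearZ /= -!scalemxAl mxE. Qed.

Lemma formZr a x y : form x (a *: y) = a * form x y.
Proof. by rewrite !form_gram -!scalemxAr mxE. Qed.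

Lemma formC x y : form x y = - form y x.
Proof.
by rewrite /form -sumrN; apply: eq_bigr => i _; rewrite opprB ![_ * x _ _]mulrC.
Qed.

Lemma formxx x : form x x = 0.
Proof. by rewrite /form big1 // => i _; rewrite mulrC subrr. Qed.

Lemma form0l x : form 0 x = 0.
Proof. by rewrite -(scale0r x) formZl mul0r. Qed.

Lemma form_suml (I : finType) (F : I -> V) y :
  form (\sum_i F i) y = \sum_i form (F i) y.
Proof.
apply: (big_morph (fun x => form x y)) => [u v|]; first exact: formDl.
exact: form0l.
Qed.

Lemma form_sumr (I : finType) (F : I -> V) y :
  form y (\sum_i F i) = \sum_i form y (F i).
Proof.
rewrite formC form_suml -sumrN; apply: eq_bigr => i _; by rewrite -formC.
Qed.

Lemma form_el i x : form (std_e i) x = x (rshift n i) 0.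
Proof.
rewrite /form (bigD1 i) //= big1 ?addr0 => [|j ji]; rewrite !mxE !eqxx ?eq_rlshift.
  by rewrite mul1r mul0r subr0.
by rewrite (inj_eq (@lshift_inj _ _)) (negPf ji) !mul0r subr0.
Qed.

Lemma form_fl i x : form (std_f i) x = - x (lshift n i) 0.
Proof.
rewrite /form (bigD1 i) //= big1 ?addr0 => [|j ji]; rewrite !mxE !eqxx ?eq_lrshift.
  by rewrite mul1r mul0r sub0r.
by rewrite (inj_eq (@rshift_inj _ _)) (negPf ji) !mul0r subr0.
Qed.

Lemma form_er i x : form x (std_e i) = - x (rshift n i) 0.
Proof. by rewrite formC form_el. Qed.

Lemma form_fr i x : form x (std_f i) = x (lshift n i) 0.
Proof. by rewrite formC form_fl opprK. Qed.

Definition formE := (form_el, form_fl, form_er, form_fr).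

Lemma form_ee i j : form (std_e i) (std_e j) = 0 :> K.
Proof. by rewrite formE mxE eq_rlshift. Qed.

Lemma form_ff i j : form (std_f i) (std_f j) = 0 :> K.
Proof. by rewrite formE mxE eq_lrshift oppr0. Qed.

Lemma form_ef i j : form (std_e i) (std_f j) = (i == j)%:R :> K.
Proof. by rewrite formE mxE (inj_eq (@rshift_inj _ _)) eqxx andbT. Qed.

Definition similitude (nu : K) g :=
  forall x y, form (g *m x) (g *m y) = nu * form x y.

Lemma similitudeM nu mu g h :
  similitude nu g -> similitude mu h -> similitude (nu * mu) (g *m h).
Proof. by move=> hg hh x y; rewrite -!mulmxA hg hh mulrA. Qed.

Lemma GSp_similitude nu g : nu != 0 -> similitude nu g -> GSp g.
Proof.
move=> nu0 hg; split.
- apply/matrixP => i j; apply/eqP; rewrite -subr_eq0; apply/eqP.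
  transitivity (form (g *m std_e i) (g *m std_e j)); last by rewrite hg form_ee mulr0.
  rewrite !mxE /form -sumrB; apply: eq_bigr => l _.
  by rewrite -!colE !mxE.
- apply/matrixP => i j; apply/eqP; rewrite -subr_eq0; apply/eqP.
  transitivity (form (g *m std_f i) (g *m std_f j)); last by rewrite hg form_ff mulr0.
  rewrite !mxE /form -sumrB; apply: eq_bigr => l _.
  by rewrite -!colE !mxE.
- exists nu => //; apply/matrixP => i j.
  transitivity (form (g *m std_e i) (g *m std_f j)); last first.
    by rewrite hg form_ef !mxE mulr_natr.
  rewrite !mxE /form -sumrB; apply: eq_bigr => l _.
  by rewrite -!colE !mxE.
Qed.

(** From [g^T gram g = nu gram] and [gram gram = -1], the matrix
    [- nu^-1 gram g^T gram] is a left inverse of [g]. *)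
Lemma GSp_inv g : GSp g ->
  exists nu h, [/\ nu != 0, similitude nu g, h *m g = 1%:M & g *m h = 1%:M].
Proof.
move=> [h1 h2 [nu nu0 h3]].
have hgram : g^T *m gram *m g = nu *: gram.
  rewrite -[g in LHS]submxK tr_block_mx /gram !mulmx_block.
  rewrite !mulmx0 !mulmxN !mulmx1 !add0r !addr0 !mulNmx.
  rewrite h1 h2 (addrC _ (_ *m drsubmx g)) (addrC _ (_ *m ursubmx g)) !subrr h3.
  have -> : (drsubmx g)^T *m ulsubmx g = nu%:M + (ursubmx g)^T *m dlsubmx g.
    have := congr1 trmx h3; rewrite raddfB /= !trmx_mul !trmxK tr_scalar_mx => <-.
    by rewrite addrNK.
  rewrite scale_block_mx !scaler0 scalerN scalemx1.
  by rewrite addNr opprD addrNK.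
have gramK : gram *m gram = - 1%:M.
  rewrite /gram mulmx_block !mulmx0 !mul0mx !mulmxN !mulNmx mulmx1 !addr0 !add0r.
  by rewrite scalar_mx_block opp_block_mx oppr0.
have hg : (- nu^-1 *: (gram *m g^T *m gram)) *m g = 1%:M.
  rewrite -scalemxAl -!mulmxA (mulmxA g^T) hgram -scalemxAr gramK.
  by rewrite scalerA scalerN mulNr mulVf // scaleN1r opprK.
exists nu, (- nu^-1 *: (gram *m g^T *m gram)); split=> //; last exact: mulmx1C.
move=> x y; rewrite !form_gram trmx_mul !mulmxA -(mulmxA _ g^T) -(mulmxA _ _ g).
by rewrite hgram -scalemxAr -scalemxAl mxE.
Qed.

End Form.

(** * Modular lattices *)

Section Lattice.
Context (K : fieldType) (ord : K -> int) (hK : is_local_field ord).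
Context (pi : K) (hpi : uniformizer ord pi) (n : nat).
Local Notation V := 'cV[K]_(n + n).
Local Notation vge := (val_ge ord).
Implicit Types (x y z : V) (g h : 'M[K]_(n + n)) (i j : 'I_n) (L : set V).

Let pi0 : pi != 0. Proof. by case: hpi. Qed.

(** The lattice [pi ^ N O^(2n)]: the balls around 0 for the sup norm. *)
Definition ball (N : int) : set V := [set x : V | forall k, vge N (x k 0)].

(** [L] is its own dual for the form [pi ^ (- c) form].  Such an [L] is stable under
    addition and under [O], and among all subsets with this property for a given
    [c] none strictly contains another (see [modular_eq]), which turns every comparison
    of lattices below into a single inclusion. *)
Definition modular (c : int) L :=
  forall x, L x <-> (forall y, L y -> vge c (form x y)).

Lemma ball_split N x :
  ball N x <-> (forall i, vge N (x (lshift n i) 0) /\ vge N (x (rshift n i) 0)).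
Proof.
split=> [h i|h k]; first by split; apply: h.
by case: (split_ordP k) => i ->; case: (h i).
Qed.

Lemma form_ball M N x y : ball M x -> ball N y -> vge (M + N) (form x y).
Proof.
move=> hx hy; apply: (val_ge_sum hK) => i.
by apply: (val_geB hK); apply: (val_geM hK); (apply: hx || apply: hy).
Qed.

Lemma ballZ N a x : a != 0 -> ball (ord a + N) (a *: x) <-> ball N x.
Proof. by move=> a0; split=> h i; have := h i; rewrite mxE (val_geZ hK). Qed.

Lemma ball_e N i : ball N (pi ^ N *: std_e i).
Proof.
move=> j; rewrite !mxE eqxx andbT.
by case: eqP => _; rewrite ?mulr1 ?mulr0; [apply/(val_ge_expz hK hpi)|left].
Qed.

Lemma ball_f N i : ball N (pi ^ N *: std_f i).
Proof.
move=> j; rewrite !mxE eqxx andbT.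
by case: eqP => _; rewrite ?mulr1 ?mulr0; [apply/(val_ge_expz hK hpi)|left].
Qed.

Lemma ball_subset (i0 : 'I_n) M N : ball M `<=` ball N -> N <= M.
Proof.
move=> /(_ _ (ball_e M i0)) /(_ (lshift n i0)).
by rewrite !mxE !eqxx mulr1 => /(val_ge_expz hK hpi).
Qed.

(** Testing against [pi ^ M] times the standard basis reads off the coordinates,
    so the dual of a ball is a ball. *)
Lemma ball_dual M c x :
  (forall y, ball M y -> vge c (form x y)) -> ball (c - M) x.
Proof.
move=> h; apply/ball_split => i; split.
- have := h _ (ball_f M i); rewrite formZr form_fr => hx.
  apply/(val_geZ hK (c - M) _ (expfz_neq0 M pi0)).
  by rewrite (ord_expz hK hpi) addrC subrK.
- have := h _ (ball_e M i); rewrite formZr form_er mulrN => /(val_geN hK).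
  rewrite opprK => hx; apply/(val_geZ hK (c - M) _ (expfz_neq0 M pi0)).
  by rewrite (ord_expz hK hpi) addrC subrK.
Qed.

Lemma modular_ball N : modular (N + N) (ball N).
Proof.
move=> x; split=> [hx y hy|/ball_dual]; first exact: form_ball.
by rewrite addrK.
Qed.

Lemma modular_ball_level (i0 : 'I_n) c N : modular c (ball N) -> c = N + N.
Proof.
move=> hc; apply/eqP; rewrite eq_le; apply/andP; split.
- have := (hc _).1 (ball_e N i0) _ (ball_f N i0).
  rewrite formZl formZr form_ef eqxx mulr1 -expfzDr //.
  by move/(val_ge_expz hK hpi).
- have /(ball_subset i0) : ball (c - N) `<=` ball N; last by lia.
  move=> x hx; apply/hc => y hy; rewrite -(subrK N c); exact: form_ball.
Qed.

(** Duality reverses inclusions: [L `<=` L'] gives [L' = L'^dual `<=` L^dual = L]. *)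
Lemma modular_eq c L L' : modular c L -> modular c L' -> L `<=` L' -> L = L'.
Proof.
move=> hL hL' sub; apply/seteqP; split=> // x hx.
by apply/hL => y /sub; apply: (hL' x).1.
Qed.

Lemma modular_dilate c a L : a != 0 -> modular c L ->
  modular (ord a + (ord a + c)) (dilate a L).
Proof.
move=> a0 hL x; split=> [[x' hx <-] _ [y hy <-]|h].
  rewrite formZl formZr.
  by apply/(val_geZ hK _ _ a0)/(val_geZ hK _ _ a0); apply: (hL x').1.
exists (a^-1 *: x); last by rewrite scalerA divff ?scale1r.
apply/hL => y hy; apply/(val_geZ hK _ _ a0).1/(val_geZ hK _ _ a0).1.
by rewrite formZl mulVKf // -formZr; apply: h; exists y.
Qed.

Lemma modular_mul c nu g h L : nu != 0 -> similitude nu g -> g *m h = 1%:M ->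
  modular c L -> modular (ord nu + c) (mul_lattice g L).
Proof.
move=> nu0 hg gh hL x; split=> [[x' hx <-] _ [y hy <-]|hx].
  by rewrite hg; apply/(val_geZ hK _ _ nu0); apply: (hL x').1.
exists (h *m x); last by rewrite mulmxA gh mul1mx.
apply/hL => y hy; apply/(val_geZ hK c _ nu0); rewrite -hg mulmxA gh mul1mx.
by apply: hx; exists y.
Qed.

(** Non-degeneracy modulo [pi] is unimodularity.  A vector [x] pairing integrally
    with [L] has a multiple [pi ^ m x] in [L], because [L] contains a ball; as long
    as [m > 0] this multiple lies in the radical modulo [pi], so one factor [pi]
    can be removed. *)
Lemma primitive_modular N L : primitive ord pi L -> ball N `<=` L -> modular 0 L.
Proof.
move=> [_ intL radL] sub x; split=> [hx y hy|hx]; first exact: intL.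
have clear_pi m : L (pi ^+ m *: x) -> L x.
  elim: m => [|m IH]; first by rewrite expr0 scale1r.
  move=> hm; apply: IH; have := radL _ hm.
  rewrite exprS -scalerA; case=> [y hy|y hy /(scalerI pi0) <- //].
  rewrite formZl (piOE hK hpi) -[1]addr0; apply: (val_geM hK).
    by right; case: hpi => _ ->.
  rewrite formZl -[0]addr0; apply: (val_geM hK); last exact: hx.
  by right; rewrite exprnP (ord_expz hK hpi).
have [M hM] : exists M : nat, ball (- M%:Z) x.
  exists (\max_k `|ord (x k 0%R)|%N) => k; right.
  have := @leq_bigmax _ (fun k => `|ord (x k 0%R)|%N) k; lia.
apply: (clear_pi (M + `|N|)%N); apply: sub => k.
apply: (@val_ge_leq K ord (`|N|)%:Z); first by lia.
have /(ballZ _ _ (expf_neq0 (M + `|N|) pi0)) := hM => /(_ k).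
by rewrite exprnP (ord_expz hK hpi) (_ : _ + _ = `|N|%:Z); last lia.
Qed.

Lemma dilate_ball a N : a != 0 -> dilate a (ball N) = ball (ord a + N).
Proof.
move=> a0; apply/seteqP; split=> [_ [x hx <-]|x hx]; first exact/ballZ.
exists (a^-1 *: x); last by rewrite scalerA divff ?scale1r.
by apply/(ballZ N _ a0); rewrite scalerA divff ?scale1r.
Qed.

Lemma dilate_comp a b L : dilate a (dilate b L) = dilate (a * b) L.
Proof.
apply/seteqP; split=> [_ [_ [x hx <-] <-]|_ [x hx <-]].
  by exists x => //; rewrite scalerA.
by exists (b *: x); [exists x|rewrite scalerA].
Qed.

Lemma dilate1 L : dilate 1 L = L.
Proof.
apply/seteqP; split=> [_ [x hx <-]|x hx]; first by rewrite scale1r.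
by exists x; rewrite ?scale1r.
Qed.

Lemma hclass_refl L : hclass L L.
Proof. by exists 1; rewrite ?oner_neq0 ?dilate1. Qed.

Lemma hclass_eq L L' : hclass L L' -> hclass L' = hclass L.
Proof.
move=> [a a0 ->]; apply/seteqP; split=> M [b b0 ->].
  by exists (b * a); rewrite ?mulf_neq0 // dilate_comp.
by exists (b / a); rewrite ?mulf_neq0 ?invr_eq0 // dilate_comp divfK.
Qed.

Lemma hclass_ball N : hclass (ball N) = vertex_o n ord.
Proof.
apply: hclass_eq; exists (pi ^ N); first exact: expfz_neq0.
by rewrite -[[set _ | _]]/(ball 0) dilate_ball ?expfz_neq0 // (ord_expz hK hpi) addr0.
Qed.

Lemma vertex_o_ball L : vertex_o n ord L -> exists N, L = ball N.
Proof. by case=> a a0 ->; exists (ord a + 0); rewrite -dilate_ball. Qed.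

(** * Symplectic frames *)

Lemma symplectic_basis_span (u w : 'I_n -> V) :
  (forall i j, form (u i) (w j) = (i == j)%:R) ->
  (forall i j, form (u i) (u j) = 0) -> (forall i j, form (w i) (w j) = 0) ->
  (forall x, exists c d, x = \sum_i c i *: u i + \sum_i d i *: w i) ->
  symplectic_basis u w.
Proof.
move=> uw uu ww hx; split=> //; rewrite basisEdim; apply/andP; split.
  apply/subvP => x _; have [c [d ->]] := hx x; rewrite span_cat.
  apply: memv_add; apply: memv_suml => i _; apply: memvZ; apply: memv_span;
    exact: map_f (mem_enum _ _).
by rewrite size_cat !size_map -enumT size_enum_ord dimvf /dim /= muln1.
Qed.

Section Frame.
Context (u w : 'I_n -> V) (huw : symplectic_basis u w).

Lemma form_frame_w c d j :
  form (\sum_i c i *: u i + \sum_i d i *: w i) (w j) = c j.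
Proof.
case: huw => _ uw _ ww; rewrite formDl !form_suml (bigD1 j) //= !big1 => [|i _|i ij].
- by rewrite !addr0 formZl uw eqxx mulr1.
- by rewrite formZl ww mulr0.
- by rewrite formZl uw (negPf ij) mulr0.
Qed.

Lemma form_frame_u c d j :
  form (u j) (\sum_i c i *: u i + \sum_i d i *: w i) = d j.
Proof.
case: huw => _ uw uu _; rewrite formDr !form_sumr big1 => [|i _].
  rewrite (bigD1 j) //= big1 => [|i ij]; last first.
    by rewrite formZr uw eq_sym (negPf ij) mulr0.
  by rewrite add0r addr0 formZr uw eqxx mulr1.
by rewrite formZr uu mulr0.
Qed.

Lemma frame_expand x :
  x = \sum_i form x (w i) *: u i + \sum_i form (u i) x *: w i.
Proof.
have span_seq (v : 'I_n -> V) y : y \in <<[seq v i | i : 'I_n]>>%VS ->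
    exists c, y = \sum_i c i *: v i.
  rewrite span_def big_map big_enum /= => /memv_sumP [vs hvs ->].
  have /choice [c hc] i : exists k, vs i = k *: v i.
    by have /vlineP [k ->] := hvs i isT; exists k.
  by exists c; apply: eq_bigr => i _; rewrite hc.
case: (huw) => hb _ _ _; have := memvf x; rewrite -(span_basis hb) span_cat.
move=> /memv_addP [y /span_seq [c ->] [z /span_seq [d ->] ->]].
by congr (_ + _); apply: eq_bigr => i _; rewrite ?form_frame_w ?form_frame_u.
Qed.

(** In a symplectic basis the coordinates of [x] are pairings with the dual basis
    vectors, so membership in a frame lattice is a condition on the form alone. *)
Lemma frame_latticeP a b x : frame_lattice ord pi u w a b x <->
  (forall i, vge (a i) (form x (w i)) /\ vge (b i) (form (u i) x)).
Proof.
have out0 (z : int) (t : K) : vge 0 t -> vge z (t * pi ^ z).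
  by move=> hy; rewrite -[X in vge X _]add0r; apply: (val_geM hK) => //;
    apply/(val_ge_expz hK hpi).
split=> [[c [d [hc hd ->]]] i|h].
  under eq_bigr do rewrite scalerA.
  under [X in _ + X]eq_bigr do rewrite scalerA.
  rewrite form_frame_w form_frame_u.
  by split; apply: out0; [exact: hc|exact: hd].
exists (fun i => form x (w i) / pi ^ a i), (fun i => form (u i) x / pi ^ b i).
split=> [i|i|].
- by rewrite /val_ring -(subrr (a i)); apply: (val_ge_divz hK hpi); case: (h i).
- by rewrite /val_ring -(subrr (b i)); apply: (val_ge_divz hK hpi); case: (h i).
- under eq_bigr do rewrite scalerA divfK ?expfz_neq0 //.
  under [X in _ + X]eq_bigr do rewrite scalerA divfK ?expfz_neq0 //.
  exact: frame_expand.
Qed.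

(** Special vertices are those represented by modular lattices: the dual basis of
    [pi ^ a_i u_i], [pi ^ b_i w_i] for the form [pi ^ (- c) form] is, up to sign,
    [pi ^ (c - a_i) w_i], [pi ^ (c - b_i) u_i]. *)
Lemma modular_frame a b c : (forall i, a i + b i = c) ->
  modular c (frame_lattice ord pi u w a b).
Proof.
case: (huw) => _ uw uu ww abc x; split=> [/frame_latticeP hx y /frame_latticeP hy|h].
  rewrite (frame_expand x) formDl !form_suml.
  apply: (val_geD hK); apply: (val_ge_sum hK) => i; rewrite formZl -(abc i).
    by apply: (val_geM hK); [case: (hx i)|case: (hy i)].
  rewrite (formC (w i)) mulrN addrC; apply: (val_geN hK).
  by apply: (val_geM hK); [case: (hx i)|case: (hy i)].
have test (z : int) (t : K) : vge c (pi ^ z * t) -> vge (c - z) t.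
  move=> hy; apply/(val_geZ hK (c - z) _ (expfz_neq0 z pi0)).
  by rewrite (ord_expz hK hpi) addrC subrK.
apply/frame_latticeP => i; split.
- have := h (pi ^ b i *: w i); rewrite formZr => hy.
  rewrite (_ : a i = c - b i); last by rewrite -(abc i) addrK.
  apply/test/hy/frame_latticeP => j.
  rewrite formZl formZr ww uw mulr0; split; [exact: val_ge0|].
  case: eqP => [->|_]; last by rewrite mulr0; left.
  by rewrite mulr1; apply/(val_ge_expz hK hpi).
- have := h (pi ^ a i *: u i); rewrite formZr formC mulrN => hy.
  rewrite (_ : b i = c - a i); last by rewrite -(abc i) addrC addKr.
  apply/test; rewrite -[_ * _]opprK; apply/(val_geN hK)/hy/frame_latticeP => j.
  rewrite formZl formZr uu uw mulr0; split; [|exact: val_ge0].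
  case: eqP => [->|_]; last by rewrite mulr0; left.
  by rewrite mulr1; apply/(val_ge_expz hK hpi).
Qed.

Lemma lattice_frame a b : is_lattice ord (frame_lattice ord pi u w a b).
Proof.
pose v (k : 'I_(n + n)) := match split k with
  inl i => pi ^ a i *: u i | inr i => pi ^ b i *: w i end.
have vl i : v (lshift n i) = pi ^ a i *: u i by rewrite /v (unsplitK (inl i)).
have vr i : v (rshift n i) = pi ^ b i *: w i by rewrite /v (unsplitK (inr i)).
have sumv c : \sum_k c k *: v k =
    \sum_i (c (lshift n i) * pi ^ a i) *: u i
    + \sum_i (c (rshift n i) * pi ^ b i) *: w i.
  by rewrite big_split_ord /=; congr (_ + _); apply: eq_bigr => i _;
    rewrite ?vl ?vr scalerA.
exists v; split=> [c _ hc k|].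
  apply/eqP; case: (split_ordP k) => i ->.
  - have := congr1 (fun x => form x (w i)) hc.
    rewrite sumv form_frame_w form0l => /eqP.
    by rewrite mulf_eq0 (negPf (expfz_neq0 _ pi0)) orbF.
  - have := congr1 (fun x => form (u i) x) hc.
    rewrite sumv form_frame_u formC form0l oppr0 => /eqP.
    by rewrite mulf_eq0 (negPf (expfz_neq0 _ pi0)) orbF.
apply/seteqP; split=> x /=.
- move=> [c [d [hc hd ->]]].
  exists (fun k => match split k with inl i => c i | inr i => d i end).
    by move=> k; case: (split k).
  rewrite sumv; congr (_ + _); apply: eq_bigr => i _;
    by rewrite scalerA ?(unsplitK (inl i)) ?(unsplitK (inr i)).
- move=> [c hc ->]; exists (c \o lshift n), (c \o @rshift n n).
  split=> [i|i|]; [exact: hc|exact: hc|].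
  by rewrite sumv; congr (_ + _); apply: eq_bigr => i _; rewrite /= scalerA.
Qed.

End Frame.

Lemma std_symplectic_basis : symplectic_basis (@std_e K n) (@std_f K n).
Proof.
apply: symplectic_basis_span; [exact: form_ef|exact: form_ee|exact: form_ff|].
move=> x; exists (fun i => x (lshift n i) 0), (fun i => x (rshift n i) 0).
apply/matrixP => k j; rewrite ord1 {j}.
rewrite [LHS](_ : _ = (\sum_l x l 0 *: delta_mx l 0 : V) k 0).
  by rewrite big_split_ord.
congr (fun_of_matrix _ k 0); rewrite [LHS]matrix_sum_delta.
by apply: eq_bigr => i _; rewrite big_ord1.
Qed.

Lemma frame_std a b x : frame_lattice ord pi (@std_e K n) (@std_f K n) a b x <->
  (forall i, vge (a i) (x (lshift n i) 0) /\ vge (b i) (x (rshift n i) 0)).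
Proof.
rewrite (frame_latticeP std_symplectic_basis); split=> h i; have := h i;
  by rewrite form_fr form_el.
Qed.

Lemma ball_frame N :
  ball N = frame_lattice ord pi (@std_e K n) (@std_f K n) (fun=> N) (fun=> N).
Proof. by apply/seteqP; split=> x; rewrite frame_std ball_split. Qed.

End Lattice.

(** * Eichler transformations *)

Section Eichler.
Context (K : fieldType) (n : nat).
Local Notation V := 'cV[K]_(n + n).
Implicit Types (x y e v : V) (i j k : 'I_n).

(** For [y] orthogonal to [e], this is the isometry fixing [e] that sends a vector
    [v] with [form e v = 1] to [v + y] modulo [e]; the scalar [c] adjusts the
    component along [e].  These are the elements of the unipotent radical of the
    stabilizer of the line of [e]. *)
Definition eichler e y (c : K) : 'M[K]_(n + n) :=
  1%:M + y *m (e^T *m gram K n) + e *m (y^T *m gram K n)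
  + c *: (e *m (e^T *m gram K n)).

Lemma eichlerE e y c v :
  eichler e y c *m v = v + form e v *: y + form y v *: e + (c * form e v) *: e.
Proof.
have gramE x : x^T *m gram K n *m v = (form x v)%:M.
  by rewrite [LHS]mx11_scalar -form_gram.
rewrite /eichler !mulmxDl mul1mx -scalemxAl -!(mulmxA _ (_ *m gram K n)).
by rewrite !gramE !mul_mx_scalar scalerA.
Qed.

Lemma similitude_eichler e y c : form e y = 0 -> similitude 1 (eichler e y c).
Proof.
move=> ey v z; have ye : form y e = 0 by rewrite formC ey oppr0.
rewrite !eichlerE !(formDl, formDr, formZl, formZr) !formxx ey ye.
rewrite (formC v e) (formC v y); ring.
Qed.

Lemma eichlerK e y c : form e y = 0 -> eichler e y c *m eichler e (- y) (- c) = 1%:M.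
Proof.
move=> ey; have ye : form y e = 0 by rewrite formC ey oppr0.
have on_vec (v : V) : eichler e y c *m (eichler e (- y) (- c) *m v) = v.
  rewrite [eichler e (- y) _ *m v]eichlerE !mulmxDr -!scalemxAr mulmxN !eichlerE.
  rewrite !formxx ey ye !(mulr0, scale0r, addr0) -scaleN1r formZl.
  by apply/matrixP => a b; rewrite !mxE; ring.
apply/matrixP => a b.
have := congr1 (fun x : V => x a 0) (on_vec (delta_mx b 0)).
by rewrite mulmxA -colE mxE => ->; rewrite !mxE eqxx andbT.
Qed.

End Eichler.

(** * The Bruhat decomposition for maximal isotropic subspaces *)

Section Bruhat.
Context (K : fieldType) (ord : K -> int) (hK : is_local_field ord).
Context (pi : K) (hpi : uniformizer ord pi) (n : nat).
Local Notation V := 'cV[K]_(n + n).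
Local Notation vge := (val_ge ord).
Local Notation e := (@std_e K n).
Local Notation f := (@std_f K n).
Implicit Types (x y z v : V) (g h : 'M[K]_(n + n)) (i j k : 'I_n) (L : set V).

(** The elements of [Qprime] with multiplier 1 that map [O^(2n)] onto itself.  The
    inverse is carried along because both halves of the equality
    [g O^(2n) = O^(2n)] are integrality statements. *)
Definition integral_borel g : Prop :=
  [/\ similitude 1 g, dlsubmx g = 0,
      forall i j, (j < i)%N -> ulsubmx g i j = 0
    & exists h, [/\ g *m h = 1%:M, h *m g = 1%:M,
        forall x, ball ord 0 x -> ball ord 0 (g *m x)
      & forall x, ball ord 0 x -> ball ord 0 (h *m x)]].

Lemma integral_borel1 : integral_borel 1%:M.
Proof.
rewrite /integral_borel scalar_mx_block block_mxKdl block_mxKul -scalar_mx_block.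
split=> // [x y|i j ji|]; first by rewrite !mul1mx mul1r.
  by rewrite mxE -val_eqE gtn_eqF.
by exists 1%:M; split=> [||x|x]; rewrite mul1mx.
Qed.

Lemma integral_borelM g g' :
  integral_borel g -> integral_borel g' -> integral_borel (g *m g').
Proof.
move=> [s dl ul [h [gh hg gO hO]]] [s' dl' ul' [h' [gh' hg' gO' hO']]].
have ggE : g *m g' = block_mx (ulsubmx g *m ulsubmx g')
    (ulsubmx g *m ursubmx g' + ursubmx g *m drsubmx g') 0 (drsubmx g *m drsubmx g').
  rewrite -[g in LHS]submxK -[g' in LHS]submxK mulmx_block dl dl'.
  by rewrite !mul0mx !mulmx0 !addr0 add0r.
have ggdl : dlsubmx (g *m g') = 0 by rewrite ggE block_mxKdl.
have ggul : ulsubmx (g *m g') = ulsubmx g *m ulsubmx g' by rewrite ggE block_mxKul.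
rewrite /integral_borel ggdl ggul.
split=> // [|i j ji|].
- by rewrite -[1]mul1r; apply: similitudeM.
- rewrite mxE big1 // => l _; have [li|il] := ltnP l i.
    by rewrite ul // mul0r.
  by rewrite ul' ?mulr0 // (leq_trans ji).
- exists (h' *m h); split=> [||x hx|x hx].
  + by rewrite mulmxA -(mulmxA g) gh' mulmx1.
  + by rewrite mulmxA -(mulmxA h') hg mulmx1.
  + by rewrite -mulmxA; apply/gO/gO'.
  + by rewrite -mulmxA; apply/hO'/hO.
Qed.

Lemma ball_eichler x y c v : ball ord 0 x -> ball ord 0 y -> vge 0 c ->
  ball ord 0 v -> ball ord 0 (eichler x y c *m v).
Proof.
move=> hx hy hc hv l; rewrite eichlerE !mxE.
have h0 a b : vge 0 a -> vge 0 b -> vge 0 (a * b).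
  by move=> ha hb; rewrite -[0]addr0; apply: val_geM.
have hform z : ball ord 0 z -> vge 0 (form z v).
  by move=> hz; rewrite -[0]addr0; apply: form_ball.
have [fx fy] := (hform x hx, hform y hy).
do !apply: (val_geD hK); first exact: hv.
- exact: (h0 _ _ fx (hy l)).
- exact: (h0 _ _ fy (hx l)).
- exact: (h0 _ _ (h0 _ _ hc fx) (hx l)).
Qed.

Lemma ball_std_e i : ball ord 0 (e i).
Proof. by rewrite -[e i]scale1r -[1](expr0z pi); apply: ball_e. Qed.

Lemma ball_std_f i : ball ord 0 (f i).
Proof. by rewrite -[f i]scale1r -[1](expr0z pi); apply: ball_f. Qed.

(** [eichler (e k) y c] fixes every [e j] up to a multiple [y_(f j)] of [e k]; it is
    upper triangular on the [e j] exactly because these coefficients vanish for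
    [j < k]. *)
Lemma integral_borel_eichler k y c : ball ord 0 y -> vge 0 c ->
  y (rshift n k) 0 = 0 -> (forall i, (i < k)%N -> y (rshift n i) 0 = 0) ->
  integral_borel (eichler (e k) y c).
Proof.
move=> hy hc yk yi; have ey : form (e k) y = 0 by rewrite form_el.
have ey' : form (e k) (- y) = 0 by rewrite form_el mxE yk oppr0.
have E_e a j : eichler (e k) y c a (lshift n j) =
    (e j - y (rshift n j) 0 *: e k) a 0.
  transitivity ((eichler (e k) y c *m e j) a 0); first by rewrite /std_e -colE [RHS]mxE.
  by rewrite eichlerE form_ee form_er mulr0 !scale0r !addr0 scaleNr.
have dl (M : 'M[K]_(n + n)) i j : dlsubmx M i j = M (rshift n i) (lshift n j).
  by rewrite !mxE.
have ul (M : 'M[K]_(n + n)) i j : ulsubmx M i j = M (lshift n i) (lshift n j).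
  by rewrite !mxE.
split.
- exact: similitude_eichler.
- by apply/matrixP => i j; rewrite dl E_e !mxE !eq_rlshift mulr0 subrr.
- move=> i j ji; rewrite ul E_e !mxE !(inj_eq (@lshift_inj _ _)).
  rewrite -val_eqE (gtn_eqF ji) add0r.
  case: eqP => [ik|_]; last by rewrite mulr0 oppr0.
  by rewrite yi ?mul0r ?oppr0 // -ik.
- exists (eichler (e k) (- y) (- c)); split=> [||x|x].
  + exact: eichlerK.
  + by rewrite -{2}[y]opprK -{2}[c]opprK; apply: eichlerK.
  + by apply: ball_eichler => //; apply: ball_std_e.
  + apply: ball_eichler; [exact: ball_std_e| |exact: (val_geN hK)].
    by move=> l; rewrite mxE; apply: (val_geN hK).
Qed.

(** If [e k] is not in [L], duality provides a vector of [L] with a unit coordinate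
    along [f k].  For [i < k], the lattice contains [e i] or [f i], so in each
    product of an [i]-th coordinate of one vector of [L] with the conjugate
    coordinate of another, one factor is divisible by [pi]; deleting these
    coordinates therefore does not change the pairings with [L] modulo [pi], and
    the vector stays in [L]. *)
Lemma pivot k L : modular ord 1 L -> L `<=` ball ord 0 ->
  (forall i, (i < k)%N -> L (e i) \/ L (f i)) -> ~ L (e k) ->
  exists x, [/\ L x, x (rshift n k) 0 = 1
    & forall i, (i < k)%N -> x (lshift n i) 0 = 0 /\ x (rshift n i) 0 = 0].
Proof.
move=> hL subL hlt Lek.
have [z Lz] : exists2 z, L z & ~ vge 1 (form (e k) z).
  by apply/existsPNP => h; apply: Lek; apply/hL.
rewrite form_el; set t := z _ 0 => ht.
have t0 : t != 0 by apply: contra_notN ht => /eqP ->; left.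
have ordt : ord t = 0.
  have := subL _ Lz (rshift n k); rewrite -/t => -[/eqP|]; first by rewrite (negPf t0).
  by move=> h0; apply/eqP; rewrite eq_le h0 andbT leNgt; apply/negP => h1;
    apply: ht; right.
pose T (s : 'I_n -> 'I_(n + n)) := \col_i (if (i < k)%N then 0 else t^-1 * z (s i) 0).
exists (col_mx (T (lshift n)) (T (@rshift n n))); split; last first.
- by move=> i ik; rewrite col_mxEu col_mxEd !mxE ik.
- by rewrite col_mxEd mxE ltnn mulVf.
apply/hL => v Lv.
pose D i := z (lshift n i) 0 * v (rshift n i) 0 - z (rshift n i) 0 * v (lshift n i) 0.
have hD i : (i < k)%N -> vge 1 (D i).
  move=> ik; have hz := subL _ Lz; have hv := subL _ Lv.
  case: (hlt i ik) => hi; have := (hL _).1 hi _ Lv; have := (hL _).1 hi _ Lz.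
    rewrite !form_el => hz1 hv1; apply: (val_geB hK).
      by rewrite -[X in vge X]add0r; apply: (val_geM hK).
    by rewrite -[X in vge X]addr0; apply: (val_geM hK).
  rewrite !form_fl => /(val_geN hK) + /(val_geN hK); rewrite !opprK => hz1 hv1.
  apply: (val_geB hK).
    by rewrite -[X in vge X]addr0; apply: (val_geM hK).
  by rewrite -[X in vge X]add0r; apply: (val_geM hK).
have -> : form (col_mx (T (lshift n)) (T (@rshift n n))) v =
    t^-1 * (form z v - \sum_(i < n) (if (i < k)%N then D i else 0)).
  rewrite /form -sumrB mulr_sumr; apply: eq_bigr => i _.
  rewrite col_mxEu col_mxEd !mxE; case: ifP => _; rewrite /D; ring.
rewrite -[X in vge X]add0r; apply: (val_geM hK).
  by right; rewrite (ordV hK) // ordt oppr0.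
apply: (val_geB hK); first exact: (hL _).1 Lz _ Lv.
by apply: (val_ge_sum hK) => i; case: ifP => [/hD //|_]; left.
Qed.

(** Induction on the number [m] of hyperbolic pairs [(e k, f k)] not yet treated,
    in increasing order of [k].  If [e k] is not in [L], the vector [x] of [pivot]
    is the image of [f k] under an Eichler transformation that belongs to [Qprime] and
    fixes [e i] and [f i] for [i < k]; undoing it brings [f k] into the lattice. *)
Lemma integral_borel_reduction m L : modular ord 1 L -> L `<=` ball ord 0 ->
  (forall i, (i + m < n)%N -> L (e i) \/ L (f i)) ->
  exists2 g, integral_borel g & forall i, L (g *m e i) \/ L (g *m f i).
Proof.
elim: m L => [|m IH] L hL subL hlt.
  exists 1%:M; first exact: integral_borel1.
  by move=> i; rewrite !mul1mx; apply: hlt; rewrite addn0.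
have [nm|mn] := leqP n m.
  by apply: IH => // i im; apply: hlt; lia.
have kn : (n - m.+1 < n)%N by lia.
pose k := Ordinal kn.
have hltk i : (i < k)%N -> L (e i) \/ L (f i).
  by move=> ik; apply: hlt; move: ik; rewrite /k /=; lia.
have kP i : (i + m < n)%N -> (i < k)%N \/ i = k.
  move=> im; have [|ki] := ltnP i k; [by left|right].
  by apply: val_inj => /=; move: ki; rewrite /k /=; lia.
have [Lek|Lek] := pselect (L (e k)).
  by apply: IH => // i /kP [/hltk //|->]; left.
have [x [Lx xk xi]] := pivot hL subL hltk Lek.
(* With this c, the component along e k of the image of f k cancels. *)
pose y := x - f k; pose c := - form y (f k).
have yk : y (rshift n k) 0 = 0 by rewrite !mxE !eqxx xk subrr.
have yr i : (i < k)%N -> y (rshift n i) 0 = 0.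
  move=> ik; rewrite !mxE (xi i ik).2 (inj_eq (@rshift_inj _ _)) -val_eqE.
  by rewrite (ltn_eqF ik) subrr.
have yl i : (i < k)%N -> y (lshift n i) 0 = 0.
  by move=> ik; rewrite !mxE (xi i ik).1 eq_lrshift subrr.
have hy : ball ord 0 y.
  move=> l; rewrite !mxE; apply: (val_geB hK); first exact: subL.
  by have := ball_std_f k l; rewrite mxE.
have hc : vge 0 c.
  apply: (val_geN hK); rewrite -[0]addr0; apply: (form_ball hK) => //.
  exact: ball_std_f.
have ey : form (e k) y = 0 by rewrite form_el.
pose E := eichler (e k) y c; pose F := eichler (e k) (- y) (- c).
have EF : E *m F = 1%:M by apply: eichlerK.
have FE : F *m E = 1%:M.
  by rewrite /E -[y]opprK -[c]opprK; apply: eichlerK; rewrite form_el mxE yk oppr0.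
have F_fix v : form (e k) v = 0 -> form y v = 0 -> F *m v = v.
  by move=> h1 h2; rewrite eichlerE h1 -scaleN1r formZl h2 !mulr0 !scale0r !addr0.
have Ef : E *m f k = x.
  rewrite eichlerE form_ef eqxx mulr1 scale1r /c scaleNr addrK.
  by rewrite /y addrC subrK.
have [] := IH (mul_lattice F L).
- have := modular_mul hK (oner_neq0 K) _ FE hL; rewrite (ord_one hK) add0r; apply.
  by apply: similitude_eichler; rewrite form_el mxE yk oppr0.
- move=> _ [z /subL hz <-]; apply: ball_eichler => //; first exact: ball_std_e.
    by move=> l; rewrite mxE; apply: (val_geN hK).
  exact: (val_geN hK).
- move=> i /kP [ik|->]; last first.
    by right; exists x => //; rewrite -Ef mulmxA FE mul1mx.
  have [Le|Lf] := hltk i ik; [left; exists (e i)|right; exists (f i)] => //.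
    by apply: F_fix; rewrite ?form_ee // form_er yr // oppr0.
  apply: F_fix; last by rewrite form_fr yl.
  by rewrite form_ef -val_eqE (gtn_eqF ik).
move=> g hg hgL; exists (E *m g).
  by apply: integral_borelM => //; apply: integral_borel_eichler.
move=> i; have back z : mul_lattice F L (g *m z) -> L (E *m g *m z).
  by move=> [v Lv Fv]; rewrite -mulmxA -Fv mulmxA EF mul1mx.
by case: (hgL i) => /back; [left|right].
Qed.

(** The choice of [eps] records, for each pair, whether [g (f i)] or [g (e i)] lies
    in [L]; either membership forces the conjugate coordinate of the vectors of
    [L] to be divisible by [pi].  This gives one inclusion and, by modularity,
    equality. *)
Lemma modular_borel_orbit L : modular ord 1 L -> L `<=` ball ord 0 ->
  exists g (eps : {ffun 'I_n -> bool}), integral_borel g /\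
    L = mul_lattice g (frame_lattice ord pi e f
          (fun i => (eps i : nat)%:Z) (fun i => 1 - (eps i : nat)%:Z)).
Proof.
move=> hL subL; have [] := integral_borel_reduction hL subL (m := n).
  by move=> i; lia.
move=> g hg hgL; exists g, [ffun i => `[< L (g *m f i) >]]; split=> //.
have [sim _ _ [h [gh hg' gO hO]]] := hg.
have hM : modular ord 1 (frame_lattice ord pi e f
    (fun i => ([ffun i => `[< L (g *m f i) >]] i : nat)%:Z)
    (fun i => 1 - ([ffun i => `[< L (g *m f i) >]] i : nat)%:Z)).
  by apply: (modular_frame hK hpi (std_symplectic_basis K n)) => i; rewrite addrC subrK.
have := modular_mul hK (oner_neq0 K) sim gh hM.
rewrite (ord_one hK) add0r => hgM; apply: (modular_eq hL hgM) => y Ly.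
exists (h *m y); last by rewrite mulmxA gh mul1mx.
have hy z : form (h *m y) z = form y (g *m z).
  by rewrite -[LHS]mul1r -sim mulmxA gh mul1mx.
have By : ball ord 0 (h *m y) by apply/hO/subL.
apply/(frame_std hK hpi) => i; rewrite ffunE.
rewrite -form_fr -form_el (formC (e i)) !hy; case: asboolP => [Lf|nLf] /=.
- split; first exact: (hL _).1 Ly _ Lf.
  by rewrite subrr -hy -formC form_el; apply: By.
- split; first by rewrite -hy form_fr; apply: By.
  rewrite subr0; apply: (val_geN hK); apply: (hL _).1 Ly _ _.
  by case: (hgL i).
Qed.

End Bruhat.

(** * Neighbours of the standard vertex *)

Section Neighbors.
Context (K : fieldType) (ord : K -> int) (hK : is_local_field ord).
Context (pi : K) (hpi : uniformizer ord pi) (n : nat) (i0 : 'I_n).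
Local Notation V := 'cV[K]_(n + n).
Local Notation vge := (val_ge ord).
Local Notation ball N := (@ball K ord n N).
Local Notation o := (vertex_o n ord).
Implicit Types (L : set V).

Let pi0 : pi != 0. Proof. by case: hpi. Qed.
Let ordpi : ord pi = 1. Proof. by case: hpi. Qed.

(** The bound [N + N] is attained on [pi ^ N e_i] and [pi ^ N f_i]. *)
Lemma form_ball_ef c N :
  (forall x y : V, ball N x -> ball N y -> vge c (form x y)) -> c <= N + N.
Proof.
move=> /(_ _ _ (ball_e hK hpi N i0) (ball_f hK hpi N i0)).
rewrite formZl formZr form_ef eqxx mulr1 -expfzDr //.
by move/(val_ge_expz hK hpi).
Qed.

Lemma primitive_ball0 : primitive ord pi (ball 0).
Proof.
split=> [|x y|x hx hr].
- rewrite (ball_frame hK hpi); exact: (lattice_frame hpi (std_symplectic_basis K n)).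
- exact: (form_ball hK).
- rewrite (dilate_ball hK) // ordpi -[1 + 0]/(1 - 0)%R.
  by apply: (ball_dual hK hpi) => y /hr; rewrite (piOE hK hpi).
Qed.

(** The representative [pi ^ m O^(2n)] of the standard vertex in a chain is forced.
    The form being divisible by [pi] on it gives [m >= 1].  The inclusion of
    [pi L0] gives [L0 `<=` ball (m - 1)], hence [ball (1 - m) `<=` L0] by duality,
    and these two balls are nested only if [m <= 1]. *)
Lemma primitive_squeeze L0 m : primitive ord pi L0 -> form_in (piO ord pi) (ball m) ->
  dilate pi L0 `<=` ball m -> ball m `<=` L0 -> m = 1 /\ L0 = ball 0.
Proof.
rewrite (piOE hK hpi) => prim intm sub1 sub2.
have hL0 := primitive_modular hK hpi prim sub2.
have m_pos := form_ball_ef intm.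
have sub3 : L0 `<=` ball (m - 1).
  move=> x hx; apply/(ballZ hK (m - 1) _ pi0).
  by rewrite ordpi addrC subrK; apply: sub1; exists x.
have sub4 : ball (1 - m) `<=` L0.
  move=> x hx; apply/hL0 => y /sub3 hy.
  by rewrite (_ : 0 = (1 - m) + (m - 1)); [exact: form_ball|lia].
have /(ball_subset hK hpi i0) := subset_trans sub4 sub3.
move=> m_le; have m1 : m = 1 by lia.
split=> //; apply: (modular_eq hL0); last by rewrite m1 in sub3.
rewrite -[X in modular _ X]addr0; exact: (modular_ball hK hpi).
Qed.

(** A neighbour is represented by [L'] with [ball 1 `<=` L' `<=` ball 0], distinct
    from [ball 1], and [c]-modular for some [c] because it is special.  The two
    inclusions and the divisibility of the form on [L'] give [1 <= c <= 2], and
    [c = 2] would mean [L' = ball 1]. *)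
Lemma neighbor_in_orbit t : Yn_neighbors ord pi o t ->
  exists (eps : {ffun 'I_n -> bool}) G,
    Qstab o G /\ PGact G (vertex_x ord pi eps) = t.
Proof.
move=> [_ [_ [u [w [a [b [huw tE sumab]]]]]] [ot [_ _ [L [L' [L0]]]]]].
move=> [/(vertex_o_ball hK) [m ->] tL' prim [intL intL'] chain].
have tL'E : t = hclass L'.
  by rewrite tE; apply/esym/hclass_eq; rewrite -tE.
have L'_ball1 : L' <> ball 1.
  by move=> L'E; apply: ot; rewrite tL'E L'E (hclass_ball hK hpi).
have [m1 L00] : m = 1 /\ L0 = ball 0.
  by case: chain => -[s1 s2 s3]; apply: primitive_squeeze => //;
    apply: subset_trans; eassumption.
rewrite {}m1 {}L00 (dilate_ball hK) // ordpi addr0 in chain intL prim *.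
case: chain => -[s1 s2 s3]; last by case: L'_ball1; apply/seteqP.
have [c hc] : exists c, modular ord c L'.
  have [al al0 ->] : hclass (frame_lattice ord pi u w a b) L' by rewrite -tE.
  eexists; apply: (modular_dilate hK al0).
  by apply: (modular_frame hK hpi huw (c := a i0 + b i0)).
have c_le : c <= 1 + 1.
  by apply: form_ball_ef => x y /s2 hx /s2 hy; apply: (hc x).1.
have c_pos : 1 <= c.
  rewrite leNgt; apply/negP => c0.
  suff : 1 <= 0 + 0 :> int by [].
  have big : ball 0 `<=` L'.
    move=> x hx; apply/hc => z /s3 hz; apply: (@val_ge_leq _ _ (0 + 0)); first by lia.
    exact: form_ball.
  apply: form_ball_ef => x y /big hx /big hy; rewrite -(piOE hK hpi).
  exact: intL'.
have c1 : c = 1.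
  have [//|c2] : c = 1 \/ c = 1 + 1 by lia.
  case: L'_ball1; apply/esym/(@modular_eq _ ord _ c) => //.
  rewrite c2; exact: (modular_ball hK hpi).
rewrite {}c1 in hc; have [g [eps [hg L'E]]] := modular_borel_orbit hK hpi hc s3.
exists eps, (PGclass g); split; last by rewrite PGactE -L'E.
have [sim dl ul [h [gh hg' gO hO]]] := hg.
split.
  exists g => //; split=> //; apply: (GSp_similitude _ sim); exact: oner_neq0.
rewrite -(hclass_ball hK hpi _ 0) PGactE; congr hclass.
apply/seteqP; split=> [_ [x hx <-]|x hx]; first exact: gO.
by exists (h *m x); [exact: hO|rewrite mulmxA gh mul1mx].
Qed.

Lemma is_vertexI L : is_lattice ord L -> form_in (vge 1) L ->
  ball 1 `<=` L -> L `<=` ball 0 -> is_vertex ord pi (hclass L).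
Proof.
move=> latL intL s1 s2; exists L, (ball 0); split=> //.
- exact: primitive_ball0.
- by rewrite (piOE hK hpi).
- by rewrite (dilate_ball hK) // ordpi addr0.
Qed.

Lemma ball_leq M N : M <= N -> ball N `<=` ball M.
Proof. by move=> MN x hx i; apply: (val_ge_leq MN); apply: hx. Qed.

Lemma form_in_ball1 : form_in (vge 1) (ball 1).
Proof.
move=> x y hx hy; apply: (@val_ge_leq _ _ (1 + 1)) => //; exact: form_ball.
Qed.

Lemma special_o : special ord pi o.
Proof.
split.
  rewrite -(hclass_ball hK hpi _ 1); apply: is_vertexI => //.
  - rewrite (ball_frame hK hpi); exact: (lattice_frame hpi (std_symplectic_basis K n)).
  - exact: form_in_ball1.
  - exact: ball_leq.
exists (@std_e K n), (@std_f K n), (fun=> 0), (fun=> 0); split=> //.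
  exact: std_symplectic_basis.
by rewrite -(ball_frame hK hpi) (hclass_ball hK hpi).
Qed.

(** An element [g] of the stabilizer maps [O^(2n)] to some [pi ^ N O^(2n)], so its
    multiplier has valuation [2 N].  Rescaling the images of the standard basis by
    [pi ^ (- N)] and by the unit part of the multiplier yields a symplectic basis
    in which the image of the vertex is a frame lattice [L] with
    [ball 1 `<=` L `<=` ball 0]. *)
Lemma orbit_neighbor G (eps : {ffun 'I_n -> bool}) :
  Qstab o G -> Yn_neighbors ord pi o (PGact G (vertex_x ord pi eps)).
Proof.
move=> [[g [gGSp _ _] <-]]; rewrite -{1}(hclass_ball hK hpi _ 0) PGactE PGactE => go.
set M := frame_lattice _ _ _ _ _ _.
have [N gN] : exists N, mul_lattice g (ball 0) = ball N.
  by apply: (vertex_o_ball hK); rewrite -go; apply: hclass_refl.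
have [nu [h [nu0 sim hg gh]]] := GSp_inv gGSp.
have ordnu : ord nu = N + N.
  have := modular_mul hK nu0 sim gh (modular_ball hK hpi (n := n) 0).
  by rewrite gN !addr0 => /(modular_ball_level hK hpi i0).
pose u i := pi ^ (- N) *: (g *m std_e i); pose w i := (pi ^ N / nu) *: (g *m std_f i).
have piN0 z : pi ^ z != 0 by rewrite expfz_neq0.
have piNN : pi ^ (- N) * pi ^ N = 1 by rewrite -expfzDr // addNr.
have huw : symplectic_basis u w.
  apply: symplectic_basis_span => [i j|i j|i j|x].
  - by rewrite formZl formZr sim mulrA mulrA -(mulrA _ _ nu) mulfVK // piNN mul1r form_ef.
  - by rewrite formZl formZr sim form_ee !mulr0.
  - by rewrite formZl formZr sim form_ff !mulr0.
  - have := frame_expand (std_symplectic_basis K n) (h *m x).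
    set c := fun i => form (h *m x) (std_f i); set d := fun i => form (std_e i) (h *m x).
    move=> hx; exists (fun i => pi ^ N * c i), (fun i => nu / pi ^ N * d i).
    rewrite -[LHS]mul1mx -gh -mulmxA {1}hx mulmxDr !mulmx_sumr.
    congr (_ + _); apply: eq_bigr => i _; rewrite -scalemxAr scalerA; congr (_ *: _).
      by rewrite mulrAC (mulrC (pi ^ N)) piNN mul1r.
    by rewrite mulrAC mulrA divfK // divff // mul1r.
set a := fun i : 'I_n => (eps i : nat)%:Z in M *.
set b := fun i : 'I_n => 1 - a i in M *.
have ab i : a i + b i = 1 by rewrite addrC subrK.
pose L := frame_lattice ord pi u w a b.
have LM : dilate (pi ^ (- N)) (mul_lattice g M) = L.
  apply: (@modular_eq _ ord _ 1).
  - have hM : modular ord 1 M by apply: (modular_frame hK hpi (std_symplectic_basis K n)).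
    have := modular_dilate hK (piN0 (- N)) (modular_mul hK nu0 sim gh hM).
    by rewrite ordnu (ord_expz hK hpi) (_ : _ + _ = 1) //; lia.
  - exact: (modular_frame hK hpi huw).
  - move=> _ [_ [v /(frame_std hK hpi) hv <-] <-]; apply/(frame_latticeP hK hpi huw) => i.
    have [hvl hvr] := hv i; rewrite !formZl !formZr !sim form_fr form_el.
    rewrite !mulrA (mulfVK nu0) piNN mul1r; split=> //.
    rewrite -[b i]add0r; apply: (val_geM hK) hvr.
    right; rewrite !(ord_mul hK) ?mulf_neq0 // (ord_expz hK hpi) ordnu; lia.
have tE : hclass (mul_lattice g M) = hclass L.
  by apply/esym/hclass_eq; exists (pi ^ (- N)).
have hL : modular ord 1 L by exact: (modular_frame hK hpi huw).
have L0 : L `<=` ball 0.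
  rewrite -LM -[0](addNr N) -{2}(ord_expz hK hpi (- N)) -dilate_ball //.
  move=> _ [x [v vM <-] <-]; exists (g *m v) => //; rewrite -gN; exists v => //.
  move/(frame_std hK hpi): vM => hv; apply/ball_split => i; have [hl hr] := hv i.
  by split; [apply: val_ge_leq hl|apply: val_ge_leq hr]; rewrite /b /a; case: (eps i).
have L1 : ball 1 `<=` L.
  move=> x hx; apply/hL => y /L0 hy; rewrite -[1]addr0; exact: form_ball.
have intL : form_in (vge 1) L by move=> x y hx hy; apply: (hL x).1.
have vL : is_vertex ord pi (hclass L).
  by apply: is_vertexI => //; apply: lattice_frame.
rewrite tE; split; first exact: special_o.
  by split=> //; exists u, w, a, b; split=> // i j; rewrite !ab.
split.
  move=> oL; have /(vertex_o_ball hK) [m Lm] : o L by rewrite oL; apply: hclass_refl.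
  by move: hL; rewrite Lm => /(modular_ball_level hK hpi i0); lia.
split=> //; first by case: special_o.
exists (ball 1), L, (ball 0); split.
- by rewrite -(hclass_ball hK hpi _ 1); apply: hclass_refl.
- exact: hclass_refl.
- exact: primitive_ball0.
- by rewrite (piOE hK hpi); split=> //; apply: form_in_ball1.
- by left; split=> //; rewrite (dilate_ball hK) // ordpi addr0.
Qed.

End Neighbors.

Theorem proposition2p4 (n : nat) (hn : (2 <= n)%N)
    (K : fieldType) (ord : K -> int) (hK : is_local_field ord)
    (pi : K) (hpi : uniformizer ord pi) :
  Yn_neighbors ord pi (vertex_o n ord) =
  \bigcup_(eps in [set: {ffun 'I_n -> bool}])
    [set PGact g (vertex_x ord pi eps) | g in Qstab (vertex_o n ord)].
Proof.
have n0 : (0 < n)%N by apply: ltnW.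
pose i0 := Ordinal n0.
apply/seteqP; split=> t.
  by move=> /(neighbor_in_orbit hK hpi i0) [eps [G [hG <-]]]; exists eps => //; exists G.
by move=> [eps _ [G hG <-]]; apply: (orbit_neighbor hK hpi i0).
Qed.
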